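(* Assume the Continuum Hypothesis. Then every productively Lindelöf sequential $T_3$ space $X$ is finitely powerfully Hurewicz, i.e., $X^k$ is Hurewicz for every positive integer $k$.
   Context: A topological space is productively Lindelöf if its product with every Lindelöf space is Lindelöf. A point-cofinite cover of a space is an infinite open cover such that each point belongs to all but finitely many members of the cover. A space $Y$ is Hurewicz if for each sequence $\{\mathcal{U}_n\}_{n<\omega}$ of open covers of $Y$ without finite subcovers there are finite $\mathcal{F}_n\subseteq\mathcal{U}_n$ such that $\{\bigcup\mathcal{F}_n : n<\omega\}$ is a point-cofinite cover of $Y$. Finite powers carry the product topology. *)

(* Defs.v *)
From HB Require Import structures.
From mathcomp Require Import all_boot all_order all_algebra.
From mathcomp Require Import all_classical all_reals all_analysis.
Set Implicit Arguments. Unset Strict Implicit. Unset Printing Implicit Defensive.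
Import Order.TTheory GRing.Theory Num.Theory.
Local Open Scope classical_set_scope.

Definition CH : Prop :=
  forall A : set (set nat), countable A \/ (A #= [set: set nat])%card.

Definition open_cover {T : topologicalType} (U : set (set T)) : Prop :=
  (forall u, U u -> open u) /\ [set: T] `<=` \bigcup_(u in U) u.

Definition lindelof (T : topologicalType) : Prop :=
  forall U : set (set T), open_cover U ->
    exists V : set (set T), [/\ V `<=` U, countable V & [set: T] `<=` \bigcup_(u in V) u].

Definition productively_lindelof (X : topologicalType) : Prop :=
  forall Y : topologicalType, lindelof Y -> lindelof (X * Y)%type.

Definition has_finite_subcover {T : topologicalType} (U : set (set T)) : Prop :=
  exists F : set (set T), [/\ F `<=` U, finite_set F & [set: T] `<=` \bigcup_(u in F) u].

Definition point_cofinite_cover {T : topologicalType} (C : set (set T)) : Prop :=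
  [/\ forall u, C u -> open u, infinite_set C &
      forall x : T, finite_set [set u | C u /\ ~ u x]].

Definition hurewicz (Y : topologicalType) : Prop :=
  forall U : nat -> set (set Y),
    (forall n, open_cover (U n) /\ ~ has_finite_subcover (U n)) ->
    exists F : nat -> set (set Y),
      (forall n, F n `<=` U n /\ finite_set (F n)) /\
      point_cofinite_cover (range (fun n => \bigcup_(u in F n) u)).

Definition seq_closed {T : topologicalType} (A : set T) : Prop :=
  forall (u : nat -> T) (x : T), (forall n, A (u n)) -> u @ \oo --> x -> A x.

Definition sequential_space (T : topologicalType) : Prop :=
  forall A : set T, seq_closed A -> closed A.

Definition T3_space (T : topologicalType) : Prop :=
  regular_space T /\ accessible_space T.

Definition power (X : topologicalType) (k : nat) : topologicalType :=
  {ptws 'I_k -> X}.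

(* Main.v *)
(* A productively Lindelöf space W is Hurewicz under CH. Take countable subcovers
   and let f w n be the first index of a member of the n-th one containing w;
   Hurewicz says that one function eventually dominates every f w. If not, order
   the functions in type omega_1 and choose points x_a such that f x_a is not
   bounded pointwise by any of the functions up to a. Add the branches f x_a, as
   isolated points, to the tree of finite sequences of naturals, a neighbourhood
   of a node s containing each branch that leaves s with a large enough value.
   Branches missed by an open set containing all nodes run through a finitely
   branching tree, so they are bounded by one function and countably many: the
   space is Lindelöf. In its product with W, the uncountably many points
   (x_a, f x_a) witness the failure of Lindelöfness, because the open set
   {v | f v n <= m} misses every branch taking a value above m at n.
   Finally, finite powers of W are again productively Lindelöf, one factor at
   a time. *)
Require Import Defs.
From HB Require Import structures.
From mathcomp Require Import all_boot all_order all_algebra.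
From mathcomp Require Import all_classical all_reals all_analysis.
From mathcomp Require Import wochoice.
Set Implicit Arguments. Unset Strict Implicit. Unset Printing Implicit Defensive.
Local Open Scope classical_set_scope.

(** * Lindelöf images and finite powers *)

Lemma lindelof_image (X Y : topologicalType) (f : X -> Y) :
  continuous f -> range f = setT -> lindelof X -> lindelof Y.
Proof.
move=> /continuousP fcont fsurj Xlin U [Uopen Ucov].
have [|V [VU Vcount Vcov]] := Xlin (preimage f @` U).
  split=> [_ [u Uu <-]|x _]; first exact/fcont/Uopen.
  by have [u Uu ufx] := Ucov (f x) I; exists (f @^-1` u) => //; exists u.
have /choice[g gP] A : exists u, V A -> U u /\ f @^-1` u = A.
  by have [/VU[u Uu fuA]|nVA] := pselect (V A); [exists u|exists set0].
exists (g @` V); split=> [_ [A VA <-]||y _].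
- by have [] := gP A VA.
- exact: sub_countable (card_image_le _ _) Vcount.
have [x _ <-] : range f y by rewrite fsurj.
have [A VA Ax] := Vcov x I; exists (g A); first by exists A.
by have [_ gA] := gP A VA; move: Ax; rewrite -{1}gA.
Qed.

Lemma continuous_ptws (I : Type) (X Y : topologicalType) (f : Y -> {ptws I -> X}) :
  (forall i, continuous (fun y => f y i)) -> continuous f.
Proof.
move=> fcont y; apply/cvg_sup => i; move: y.
apply/(@continuousP _ (initial_topology (fun h : I -> X => h i))) => _ [B Bopen <-].
exact: (continuousP _).1 (fcont i) B Bopen.
Qed.

Lemma continuous_ptws_eval (I : eqType) (X : topologicalType) (i : I) :
  continuous (fun h : {ptws I -> X} => h i).
Proof. exact: (@proj_continuous I (fun=> X) i). Qed.

Lemma continuous_fst (X Y : topologicalType) : continuous (@fst X Y).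
Proof. by move=> [a b]; exact: cvg_fst. Qed.

Lemma continuous_snd (X Y : topologicalType) : continuous (@snd X Y).
Proof. by move=> [a b]; exact: cvg_snd. Qed.

(** Induction on [k] for all [Y] at once: [X * (power X k * Y)] is Lindelöf and maps continuously
    onto [power X k.+1 * Y]. *)
Lemma productively_lindelof_power (X : topologicalType) (k : nat) :
  productively_lindelof X -> productively_lindelof (power X k).
Proof.
move=> Xprod; elim: k => [|k IH] Y Ylin.
  pose f (y : Y) : (power X 0 * Y)%type :=
    ((fun i : 'I_0 => False_rect X (notF (ltn_ord i))) : power X 0, y).
  apply: (lindelof_image (f := f)) Ylin.
    move=> y; apply: (@cvg_pair _ _ _ (nbhs y) (nbhs (f y).1) (nbhs (f y).2)) => //.
    exact: cvg_cst.
  apply/seteqP; split=> // -[h y] _; exists y => //; congr pair.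
  by apply: funext => -[].
pose coordinate i (p : (X * (power X k * Y))%type) : X :=
  if unlift ord0 i is Some j then p.2.1 j else p.1.
have coordinate_cont i : continuous (coordinate i).
  rewrite /coordinate; case: (unlift ord0 i) => [j|]; last exact: continuous_fst.
  move=> p; apply: (@continuous_comp _ (power X k) _
    (fun q : X * (power X k * Y) => q.2.1) (fun h : power X k => h j));
    last exact: continuous_ptws_eval.
  apply: (@continuous_comp _ (power X k * Y)%type _ snd fst).
    exact: continuous_snd.
  exact: continuous_fst.
pose f (p : (X * (power X k * Y))%type) : (power X k.+1 * Y)%type :=
  ((coordinate^~ p) : power X k.+1, p.2.2).
apply: (lindelof_image (f := f)) (Xprod _ (IH Y Ylin)).
  move=> p; apply: (@cvg_pair _ _ _ (nbhs p) (nbhs (f p).1) (nbhs (f p).2)).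
    exact: (@continuous_ptws _ _ _ (fun p => (coordinate^~ p) : power X k.+1)).
  apply: (@continuous_comp _ (power X k * Y)%type _ snd snd); exact: continuous_snd.
apply/seteqP; split=> // -[h y] _.
exists (h ord0, ((fun j => h (lift ord0 j)) : power X k, y)) => //.
congr pair; apply: funext => i /=.
by rewrite /coordinate; case: (unliftP ord0 i) => [j ->|->].
Qed.

(** * Eventual domination and the order obtained from CH *)

Lemma eventual_dominating (A : set (nat -> nat)) : countable A ->
  exists g : nat -> nat, forall h, A h -> exists N, forall n, N <= n -> h n <= g n.
Proof.
move=> /countable_injP[c cinj].
have /choice[e eP] m : exists h, forall h', A h' -> c h' = m -> h = h'.
  have [[h Ah chm]|nh] := pselect (exists2 h, A h & c h = m).
    by exists h => h' Ah' ch'm; apply: cinj; rewrite ?inE// chm.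
  by exists (fun=> 0) => h' Ah' ch'm; case: nh; exists h'.
(* Diagonal maximum: the function with code [m] enters at [n = m] and is dominated from there on. *)
exists (fun n => \max_(m < n.+1) e m n) => h Ah; exists (c h) => n cn.
rewrite -[h in h n](eP (c h) h)//.
by rewrite -ltnS in cn; exact: (leq_bigmax (Ordinal cn)).
Qed.

Lemma uncountable_baire : ~ countable [set: nat -> nat].
Proof.
move=> /eventual_dominating[g] /(_ (fun n => (g n).+1) I)[N /(_ N (leqnn N))].
by rewrite ltnn.
Qed.

Lemma baire_card_le : ([set: nat -> nat] #<= [set: set nat])%card.
Proof.
apply/pcard_injP; exists (fun f => [set c | exists n, c = pickle (n, f n)]).
move=> f g _ _ fg; apply: funext => n.
have : [set c | exists n, c = pickle (n, f n)] (pickle (n, f n)) by exists n.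
by rewrite fg => -[m /(pcan_inj pickleK)[-> ->]].
Qed.

Lemma countable_setU (T : Type) (A B : set T) :
  countable A -> countable B -> countable (A `|` B).
Proof.
move=> Ac Bc.
apply: (@sub_countable _ _ _ (\bigcup_(b in [set: bool]) if b then A else B)).
  by apply: subset_card_le => x [Ax|Bx]; [exists true|exists false].
by apply: bigcup_countable => // -[].
Qed.

(** In a well-order [S] of all functions, the set [D] of those with countably many predecessors is
    uncountable. CH gives [D] the size of the continuum, and [R] is [S] pulled back along an
    injection into [D]. *)
Lemma CH_order : CH -> exists R : rel (nat -> nat), total R /\
  forall g, countable [set h | R h g].
Proof.
move=> ch; have [S Swo] := well_ordering_principle (nat -> nat).
have Stot : total S.
  move=> f g; have [|h [[]]] := Swo [pred x | (x == f) || (x == g)].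
    by exists f; rewrite inE eqxx.
  rewrite inE => /orP[]/eqP -> hlb _.
    by rewrite (hlb g)// inE eqxx orbT.
  by rewrite (hlb f) ?orbT// inE eqxx.
have Santi f g : S f g -> S g f -> f = g.
  move=> fg gf; have [|h [_ huniq]] := Swo [pred x | (x == f) || (x == g)].
    by exists f; rewrite inE eqxx.
  have Srefl x : S x x by have /orP[] := Stot x x.
  apply: etrans (esym (huniq f _)) (huniq g _); split; rewrite ?inE ?eqxx ?orbT//;
    by move=> x; rewrite inE => /orP[]/eqP ->.
pose D := [set f | countable [set h | S h f]].
have Duncount : ~ countable D.
  (* If [D] were countable, there would be a least [f] outside it; its predecessors are in [D] or
     equal to [f], so they are countably many and [f] is in [D]. *)
  move=> Dcount; have [|f] := Swo [pred f | ~~ `[< D f >]].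
    apply: contrapT => nD; apply: uncountable_baire.
    apply: sub_countable Dcount; apply: subset_card_le => f _.
    by apply: contrapT => nDf; apply: nD; exists f; rewrite inE; apply/asboolPn.
  case=> -[]; rewrite inE => /asboolPn nDf flb _; apply: nDf.
  apply: (@sub_countable _ _ _ (D `|` [set f])).
    apply: subset_card_le => h /= Shf.
    have [Dh|nDh] := pselect (D h); [by left|right].
    by apply: Santi => //; apply: flb; rewrite inE; apply/asboolPn.
  exact: countable_setU.
have /pcard_injP[code code_inj] := baire_card_le.
(* [CH] speaks of sets of sets of naturals, so [D] is moved there by [code]. *)
have cD : (code @` D #= D)%card.
  by apply: inj_card_eq => f g _ _; apply: code_inj; rewrite inE.
have Dfull : (D #= [set: set nat])%card.
  have [|cDset] := ch (code @` D); first by rewrite (eq_countable cD).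
  exact: card_eq_trans (card_esym cD) cDset.
have : ([set: nat -> nat] #<= D)%card.
  by rewrite (card_le_eqr Dfull); exact: baire_card_le.
move=> /pcard_leP[phi].
have phiD f : D (phi f) by exact: funS.
have phi_inj : injective phi by move=> f g; apply: inj; rewrite inE.
exists (fun f g => S (phi f) (phi g)); split=> [f g|g]; first exact: Stot.
apply: sub_countable (phiD g).
rewrite -(card_le_eql (inj_card_eq (f := phi) _)); last by move=> ? ? _ _ /phi_inj.
by apply: subset_card_le => _ [h Shg <-].
Qed.

(* Nodes [inl s] and branches [inr i]; [y] is a parameter of the type so that the
   topology depending on it is inferred from the type. *)
Definition thread_space (I : choiceType) (y : I -> nat -> nat) : Type :=
  (seq nat + I)%type.

(** * The tree of finite sequences with added branches *)

Section ThreadSpace.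
Variables (I : choiceType) (y : I -> nat -> nat).
Local Notation thread_space := (thread_space y).

HB.instance Definition _ := Choice.copy thread_space (seq nat + I)%type.

(** Branches are named by their indices, so equal branches with different indices stay distinct
    points. A neighbourhood of a node need not contain any other node. *)
Definition thread_open (V : set thread_space) :=
  forall s, V (inl s) -> exists m, forall i,
    mkseq (y i) (size s) = s -> m <= y i (size s) -> V (inr i).

Let thread_openT : thread_open setT.
Proof. by move=> s _; exists 0. Qed.

Let thread_openI : setI_closed thread_open.
Proof.
move=> A B Aop Bop s [As Bs]; have [a aP] := Aop s As; have [b bP] := Bop s Bs.
exists (maxn a b) => i si; rewrite geq_max => /andP[ai bi].
by split; [exact: aP|exact: bP].
Qed.

Let thread_open_bigU (J : Type) (f : J -> set thread_space) :
  (forall j, thread_open (f j)) -> thread_open (\bigcup_j f j).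
Proof.
move=> fop s [j _ fjs]; have [m mP] := fop j s fjs.
by exists m => i si mi; exists j => //; exact: mP.
Qed.

HB.instance Definition _ := isOpenTopological.Build thread_space
  thread_openT thread_openI thread_open_bigU.

Lemma thread_openE (V : set thread_space) : open V = thread_open V.
Proof. by []. Qed.

Definition node_nbhs (s : seq nat) (m : nat) : set thread_space :=
  [set p | match p with
           | inl t => t = s
           | inr i => mkseq (y i) (size s) = s /\ m <= y i (size s)
           end].

Lemma open_node_nbhs s m : open (node_nbhs s m).
Proof. by rewrite thread_openE => _ ->; exists m. Qed.

Lemma open_thread i : open [set inr i : thread_space].
Proof. by rewrite thread_openE => s. Qed.

(* [h s] bounds the value with which a branch may leave [s]: a branch respecting
   all these bounds runs through a finitely branching tree. *)
Fixpoint bounded_nodes (h : seq nat -> nat) n : seq (seq nat) :=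
  if n is n'.+1 then
    flatten [seq [seq rcons s k | k <- iota 0 (h s)] | s <- bounded_nodes h n']
  else [:: [::]].

Lemma bounded_nodesP (h : seq nat -> nat) (f : nat -> nat) :
  (forall n, f n < h (mkseq f n)) -> forall n, mkseq f n \in bounded_nodes h n.
Proof.
move=> fh; elim=> // n IH; apply/flatten_mapP; exists (mkseq f n) => //.
rewrite mkseqS; apply/mapP; exists (f n) => //.
by rewrite mem_iota add0n fh.
Qed.

Lemma lindelof_thread_space :
  (forall g : nat -> nat, countable [set i | forall n, y i n <= g n]) ->
  lindelof thread_space.
Proof.
move=> bounded_count U [Uop Ucov].
have /choice[u uP] p : exists u, U u /\ u p by have [u] := Ucov p Logic.I; exists u.
have /choice[h hP] s : exists m, forall i,
    mkseq (y i) (size s) = s -> m <= y i (size s) -> u (inl s) (inr i).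
  have [Us us] := uP (inl s); have := Uop _ Us.
  by rewrite thread_openE => /(_ s us).
pose g n := \max_(s <- bounded_nodes h n) h s.
pose A := [set i | forall n, y i n <= g n].
exists (range (fun s => u (inl s)) `|` (fun i => u (inr i)) @` A); split.
- move=> _ [[s _ <-]|[i _ <-]]; first by have [] := uP (inl s).
  by have [] := uP (inr i).
- apply: countable_setU.
    exact: sub_countable (card_image_le _ _) (countableP _).
  exact: sub_countable (card_image_le _ _) (bounded_count g).
move=> [s|i] _.
  by exists (u (inl s)); [left; exists s|have [] := uP (inl s)].
(* Either the branch leaves one of its nodes with a value at least [h] and is covered by the set
   chosen there, or it stays below [h] and its index lies in [A]. *)
have [[n hn]|nh] := pselect (exists n, h (mkseq (y i) n) <= y i n).
  exists (u (inl (mkseq (y i) n))); first by left; eexists.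
  by apply: hP; rewrite size_mkseq.
exists (u (inr i)); last by have [] := uP (inr i).
right; exists i => // n.
have fh m : y i m < h (mkseq (y i) m).
  by rewrite ltnNge; apply/negP => ?; apply: nh; exists m.
apply: leq_trans (ltnW (fh n)) _.
by apply: leq_bigmax_seq => //; exact: bounded_nodesP.
Qed.

End ThreadSpace.

(** * Domination over productively Lindelöf spaces *)

Lemma open_setX (X Y : topologicalType) (A : set X) (B : set Y) :
  open A -> open B -> open (A `*` B).
Proof.
rewrite !openE => Aop Bop [a b] [/= Aa Bb].
by exists (A, B); [split; [exact: Aop|exact: Bop]|].
Qed.

Lemma eventually_bounded_open_sublevels (W : topologicalType)
    (f : W -> nat -> nat) :
  CH -> productively_lindelof W ->
  (forall n m, open [set w | f w n <= m]) ->
  exists g : nat -> nat, forall w, exists N, forall n, N <= n -> f w n <= g n.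
Proof.
move=> /CH_order[R [Rtot Rcount]] Wprod fop; apply: contrapT => unbounded.
(* If each [f w] were bounded everywhere by some predecessor of [a], a function eventually
   dominating these countably many predecessors would eventually dominate every [f w]. *)
have /choice[x xP] a : exists w, forall b, R b a -> exists n, b n < f w n.
  have [g gP] := eventual_dominating (Rcount a).
  apply: contrapT => nw; apply: unbounded; exists g => w.
  have [b Rba fb] : exists2 b, R b a & forall n, f w n <= b n.
    apply: contrapT => nb; apply: nw; exists w => b Rba.
    apply: contrapT => nn; apply: nb; exists b => // n.
    by rewrite leqNgt; apply/negP => ?; apply: nn; exists n.
  have [N NP] := gP b Rba; exists N => n Nn; exact: leq_trans (fb n) (NP n Nn).
pose y a := f (x a).
have Ylin : lindelof (thread_space y).
  apply: lindelof_thread_space => g; apply: sub_countable (Rcount g).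
  apply: subset_card_le => a ag /=.
  (* [R g a] would make [y a] exceed [g] somewhere, by the choice of [x a]. *)
  have /orP[//|/xP[n]] := Rtot a g.
  by rewrite ltnNge (ag n).
pose diag (O : set (W * thread_space y)) := [set a | O (x a, inr a)].
(* The diagonal is indexed by all functions, so no countable family of open sets with countable
   trace on it can cover the product. *)
have [|V [VU Vcount Vcov]] :=
  Wprod _ Ylin [set O | open O /\ countable (diag O)].
  split=> [_ [] | [w [s|a]] _] //.
  (* A diagonal point in this box would have at [size s] a value at most [f w (size s)] by the first
     factor, and a larger one, because of the successor, by the second. *)
  - exists ([set v | f v (size s) <= f w (size s)] `*`
            node_nbhs (y := y) s (f w (size s)).+1); last by split=> /=.
    split; first by apply: open_setX => //; exact: open_node_nbhs.
    rewrite (_ : diag _ = set0); first exact: countable0.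
    rewrite -subset0 => a [/= le1 [_ lt2]].
    by move: (leq_trans lt2 le1); rewrite ltnn.
  - exists (setT `*` [set (inr a : thread_space y)]) => //.
    split; first by apply: open_setX; [exact: openT|exact: open_thread].
    apply: (@sub_countable _ _ _ [set a]); last exact: countable1.
    by apply: subset_card_le => b [_ [->]].
apply: uncountable_baire.
have dcount : countable (\bigcup_(O in V) diag O).
  by apply: bigcup_countable => // O /VU[].
apply: sub_countable dcount; apply: subset_card_le => a _.
by have [G VG Ga] := Vcov (x a, inr a) I; exists G.
Qed.

Lemma productively_lindelof_lindelof (X : topologicalType) :
  productively_lindelof X -> lindelof X.
Proof.
(* Any nonempty Lindelöf factor would do; a tree with one branch is at hand. *)
move=> Xprod; pose y (_ : unit) (_ : nat) := 0.
have Ylin : lindelof (thread_space y).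
  by apply: lindelof_thread_space => g; exact: countableP.
apply: (lindelof_image (f := fst)) (Xprod _ Ylin); first exact: continuous_fst.
by apply/seteqP; split=> // w _; exists (w, inr tt).
Qed.

(** * From domination to the Hurewicz property *)

Lemma productively_lindelof_hurewicz (W : topologicalType) :
  CH -> productively_lindelof W -> hurewicz W.
Proof.
move=> ch Wprod U UP.
have Wlin := productively_lindelof_lindelof Wprod.
have /choice[V VP] n : exists V, [/\ V `<=` U n, countable V &
    [set: W] `<=` \bigcup_(u in V) u].
  by have [Ucov _] := UP n; exact: Wlin.
have /choice[c cinj] n : exists c : set W -> nat, {in V n &, injective c}.
  by apply/countable_injP; have [] := VP n.
pose F m n := [set u | V n u /\ c n u <= m].
(* The equivalence makes the sublevel sets of [f] unions of open sets, and later turns domination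
   into membership. *)
have /choice[f fP] w : exists k : nat -> nat,
    forall n m, k n <= m <-> exists2 u, F m n u & u w.
  have /choice[k kP] n : exists k, forall m, k <= m <-> exists2 u, F m n u & u w.
    have [_ _ Vcov] := VP n; have [u Vu uw] := Vcov w I.
    have ex : exists k, `[< exists2 u, F k n u & u w >].
      by exists (c n u); apply/asboolP; exists u.
    case: (ex_minnP ex) => k /asboolP[u' [Vu' cu'] u'w] kmin; exists k => m; split.
      by move=> km; exists u' => //; split=> //; exact: leq_trans km.
    by move=> ?; apply: kmin; apply/asboolP.
  by exists k.
have [n m|g gP] := eventually_bounded_open_sublevels (f := f) ch Wprod.
  rewrite (_ : [set w | _] = \bigcup_(u in F m n) u).
    apply: bigcup_open => u [Vu _]; have [[Uop _] _] := UP n.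
    by apply: Uop; have [VU _ _] := VP n; exact: VU.
  apply/seteqP; split=> w; first by move=> /fP[u]; exists u.
  by move=> [u Fu uw]; apply/fP; exists u.
have FU n : F (g n) n `<=` U n by move=> u [Vu _]; have [VU _ _] := VP n; exact: VU.
have Ffin n : finite_set (F (g n) n).
  apply: (@card_le_finite _ _ _ `I_(g n).+1); last exact: finite_II.
  rewrite -(card_le_eql (inj_card_eq (f := c n) _)).
    by apply: subset_card_le => _ [u [_ cu] <-].
  by move=> u v; rewrite !inE => -[Vu _] [Vv _]; apply: cinj; rewrite inE.
exists (fun n => F (g n) n); split=> //.
set B := fun n => \bigcup_(u in F (g n) n) u.
have Bev w : exists N, forall n, N <= n -> B n w.
  by have [N NP] := gP w; exists N => n /NP/fP.
split.
- move=> _ [n _ <-]; apply: bigcup_open => u /FU Uu.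
  by have [[Uop _] _] := UP n; exact: Uop.
(* Each member misses a point that all [B n] contain from some index on. If the members were
   finitely many, then at the maximum [K] of these indices [B K] would contain the point it
   misses. *)
- move=> /finite_seqP[s Bs].
  have /choice[w wP] n : exists w, ~ B n w.
    apply: contrapT => nw; have [_] := UP n; apply; exists (F (g n) n).
    by split=> // w _; apply: contrapT => nBw; apply: nw; exists w.
  have /choice[M MP] A : exists m, range B A -> exists2 v, ~ A v &
      forall n, m <= n -> B n v.
    have [[n _ <-]|nA] := pselect (range B A); last by exists 0.
    by have [N NP] := Bev (w n); exists N => _; exists (w n).
  pose K := \max_(A <- s) M A.
  have BK : range B (B K) by exists K.
  have [v nBv Bv] := MP _ BK; apply/nBv/Bv.
  by apply: leq_bigmax_seq => //; move: BK; rewrite Bs.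
- move=> w; have [N NP] := Bev w.
  apply: (@sub_finite_set _ _ (B @` `I_N)); last exact/finite_image/finite_II.
  move=> _ [[n _ <-] nBw]; exists n => //=.
  by rewrite ltnNge; apply/negP => /NP.
Qed.

Theorem theorem2p8 :
  CH ->
  forall X : topologicalType,
    productively_lindelof X -> sequential_space X -> T3_space X ->
    forall k : nat, (0 < k)%N -> hurewicz (power X k).
Proof.
move=> ch X Xprod _ _ k _.
exact/productively_lindelof_hurewicz/productively_lindelof_power.
Qed.
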